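(* Let $s$ and $t$ be relatively prime positive integers, and let $X$ denote the size of a partition chosen uniformly at random from the set of $(s,t)$-core partitions. Then the third moment of $X$ about its mean is $$\mathbf{E}\big[(X-\mathbf{E}[X])^3\big]=\frac{1}{60480}\, s\,t\,(t-1)(s-1)(s+t+1)(s+t)\,\big(2s^2t+2st^2-3s^2-3st-3t^2-3\big).$$
   Context: A partition is a non-increasing finite sequence of positive integers $\lambda=(\lambda_1,\dots,\lambda_k)$, $k\ge 0$ (the empty partition is allowed); its size is $\lambda_1+\dots+\lambda_k$. Its Ferrers diagram consists of the cells $(i,j)$ with $1\le i\le k$, $1\le j\le\lambda_i$. The hook length of cell $(i,j)$ is $\lambda_i-j+\lambda'_j-i+1$, where $\lambda'$ is the conjugate partition ($\lambda'_j$ = number of $i$ with $\lambda_i\ge j$). A partition is an $s$-core if no cell has hook length equal to $s$, and an $(s,t)$-core partition if it is simultaneously an $s$-core and a $t$-core. For coprime $s,t$ the set of $(s,t)$-core partitions is finite, and it is given the uniform probability distribution. *)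

(* Defs.v *)
From HB Require Import structures.
From mathcomp Require Import all_boot all_order all_algebra finmap zify.
From mathcomp Require Import boolp classical_sets functions cardinality.

Set Implicit Arguments.
Unset Strict Implicit.
Unset Printing Implicit Defensive.

Import Order.TTheory GRing.Theory Num.Theory.

Local Open Scope classical_set_scope.

Definition is_partition (la : seq nat) : bool :=
  sorted geq la && all (fun x => 0 < x) la.

Record intpart : Type := IntPart {
  parts :> seq nat;
  _ : is_partition parts }.

HB.instance Definition _ := [isSub for parts].
HB.instance Definition _ := [Countable of intpart by <:].

Definition psize (la : intpart) : nat := sumn la.

(* Rows and columns are numbered from 1; [part la i] is 0 past the last row. *)
Definition part (la : intpart) (i : nat) : nat := nth 0 la i.-1.

Definition conj_part (la : intpart) (j : nat) : nat :=
  count (fun x => j <= x) la.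

Definition in_diagram (la : intpart) (i j : nat) : Prop :=
  1 <= i <= size la /\ 1 <= j <= part la i.

(* For cells of the diagram [j <= part la i] and [i <= conj_part la j], so
   neither subtraction is truncated. *)
Definition hook_length (la : intpart) (i j : nat) : nat :=
  (part la i - j) + (conj_part la j - i) + 1.

Definition is_core (s : nat) (la : intpart) : Prop :=
  forall i j, in_diagram la i j -> hook_length la i j <> s.

Definition cores (s t : nat) : set intpart :=
  [set la | is_core s la /\ is_core t la].

(* Expectation of [f] under the uniform distribution on the finite set [A].
   [fset_set A] is the finite set with the same elements as [A] when [A] is
   finite; see [finite_cores] below for the sets used here. *)
Definition expect (T : choiceType) (A : set T) (f : T -> rat) : rat :=
  ((\sum_(x <- fset_set A) f x) / (#|` fset_set A|)%:R)%R.

Section FinitelyManyCores.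

Implicit Types (la : intpart) (s t i j b : nat).

Lemma part_gt0 la i : 1 <= i <= size la -> 0 < part la i.
Proof.
move=> /andP[i1 ik]; have /andP[_ /allP P] := valP la.
by apply: P; apply: mem_nth; rewrite prednK.
Qed.

Lemma part_mono la i i' : 1 <= i -> i <= i' -> part la i' <= part la i.
Proof.
move=> i1 ii'; have /andP[S _] := valP la; rewrite /part.
have [k|k] := leqP (size la) i'.-1; first by rewrite nth_default.
have gt : transitive geq by move=> a b c /= h1 h2; apply: leq_trans h2 h1.
have gr : reflexive geq by move=> a /=.
have ii : i.-1 <= i'.-1 by lia.
by apply: (sorted_leq_nth gt gr 0 S) => //; rewrite inE (leq_ltn_trans ii).
Qed.

Lemma conj_partE la j r : 0 < j -> r <= size la ->
  (0 < r -> j <= part la r) -> part la r.+1 < j -> conj_part la j = r.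
Proof.
move=> j0 rk h1 h2; rewrite /conj_part -(cat_take_drop r la) count_cat.
have -> : count (fun x => j <= x) (take r la) = r.
  rewrite -[RHS](size_takel rk); apply/eqP; rewrite -all_count.
  apply/(all_nthP 0) => i; rewrite size_takel // => ir.
  rewrite nth_take //; apply: leq_trans (h1 _) _; first lia.
  by have := @part_mono la i.+1 r isT ir.
have -> : count (fun x => j <= x) (drop r la) = 0; last by rewrite addn0.
apply/eqP; rewrite -leqn0 leqNgt -has_count -all_predC.
apply/(all_nthP 0) => i _; rewrite nth_drop /= -ltnNge.
apply: leq_ltn_trans h2.
by have := @part_mono la r.+1 (r + i).+1 isT; apply; lia.
Qed.

(* The hook length of the first cell of row [i]. *)
Definition beta la i := part la i + size la - i.

Definition in_beta la b := exists2 i, 1 <= i <= size la & b = beta la i.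

Lemma in_betaB s la b : is_core s la -> in_beta la b -> s <= b ->
  in_beta la (b - s).
Proof.
move=> core [i hi ->] sb; apply: contrapT => nb.
have cst i' : 1 <= i' <= size la -> beta la i' <> beta la i - s.
  by move=> h e; apply: nb; exists i'.
have exr : exists r, (i <= r <= size la) && (beta la i - s <= beta la r).
  by exists i; rewrite leqnn; lia.
have ubr r : (i <= r <= size la) && (beta la i - s <= beta la r) ->
  r <= size la by lia.
have [r /andP[hr br] mx] := ex_maxnP exr ubr.
have {br}br : beta la i - s < beta la r by have := cst r; lia.
have nx : part la r.+1 + size la <= beta la i - s + r.
  have [e|e] := ltnP r (size la); last first.
    by have -> : part la r.+1 = 0 by [rewrite /part nth_default|]; lia.
  have := mx r.+1; rewrite /beta in br *; lia.
pose j := beta la i - s + r + 1 - size la.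
have jE : j = beta la i - s + r + 1 - size la by [].
have P := @part_mono la i r; rewrite /beta in br nx jE sb.
have j0 : 0 < j by lia.
have jr : j <= part la r by lia.
have cj : conj_part la j = r.
  by apply: conj_partE; lia.
apply: (core i j); first by split => //; lia.
by rewrite /hook_length cj; lia.
Qed.

Lemma in_beta_bound s t la b : 0 < s -> 0 < t -> coprime s t ->
  cores s t la -> in_beta la b -> b < s * t.
Proof.
move=> s0 t0 st [cs ct] hb; rewrite ltnNge; apply/negP => ge.
have dec u x c : is_core u la -> in_beta la (c + x * u) -> in_beta la c.
  move=> cu; elim: x => [|x IH]; first by rewrite addn0.
  move=> /(in_betaB cu) h; apply: IH.
  have -> : c + x * u = c + x.+1 * u - u by rewrite mulSn; lia.
  by apply: h; rewrite mulSn; lia.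
have n0 : ~ in_beta la 0.
  by move=> [i hi]; have := part_gt0 hi; rewrite /beta; lia.
have [x [y' e]] : exists x y', b = 0 + x * s + y' * t.
  have [u v e _] := egcdnP s t0; rewrite gcdnC (eqP st) in e.
  pose y := (b * u) %% s.
  have ym : y * t = b %[mod s].
    by rewrite /y modnMml -mulnA e mulnDr muln1 mulnA modnMDl.
  have yb : y * t <= b.
    apply: leq_trans ge; rewrite leq_mul2r; apply/orP; right.
    by apply: ltnW; rewrite ltn_mod.
  have /dvdnP[x ex] : s %| b - y * t by rewrite -eqn_mod_dvd // ym.
  by exists x, y; lia.
by apply: n0; apply: (dec s x) => //; apply: (dec t y') => //; rewrite -e.
Qed.

Lemma finite_cores s t : 0 < s -> 0 < t -> coprime s t ->
  finite_set (cores s t).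
Proof.
move=> s0 t0 st; pose N := s * t.
have p0 : is_partition [::] by [].
pose g (f : N.-tuple 'I_N.+1) : intpart :=
  insubd (IntPart p0) [seq x <- [seq val y | y <- f] | 0 < x].
apply: (@sub_finite_set _ _ (g @` [set: N.-tuple 'I_N.+1])); last first.
  by apply: finite_image; apply: finite_finset.
move=> la hla.
have bd i : 1 <= i <= size la -> part la i + size la - i < N.
  by move=> hi; apply: in_beta_bound hla _ => //; exists i.
have kN : size la <= N.
  case: (posnP (size la)) => [->//|k0].
  by have := bd 1; have := @part_gt0 la 1; lia.
have pN i : part la i <= N.
  have [h|h] := boolP (1 <= i <= size la); first by have := bd _ h; lia.
  case: i h => [|i] h; last by rewrite /part nth_default //=; lia.
  case: (posnP (size la)) => k0; first by rewrite /part nth_default // k0.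
  by have := bd 1; rewrite /part /=; lia.
exists [tuple inord (part la i.+1) | i < N] => //.
apply: val_inj; rewrite /g val_insubd.
suff -> : [seq x <- [seq val y | y <-
    [tuple (inord (part la i.+1) : 'I_N.+1) | i < N]] | 0 < x] = la.
  by rewrite (valP la).
have -> : [seq val y | y <- [tuple (inord (part la i.+1) : 'I_N.+1) | i < N]]
    = la ++ nseq (N - size la) 0.
  apply: (@eq_from_nth _ 0) => [|i].
    by rewrite size_map size_tuple size_cat size_nseq; lia.
  rewrite size_map size_tuple => iN.
  rewrite (nth_map ord0) ?size_tuple // -[i]/(val (Ordinal iN)).
  rewrite -tnth_nth tnth_mktuple /= inordK ?ltnS ?pN // nth_cat /part /=.
  by case: ltnP => // ?; rewrite nth_nseq if_same nth_default.
have /andP[_ /all_filterP P] := valP la.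
by rewrite filter_cat P filter_nseq /= cats0.
Qed.

End FinitelyManyCores.

(* Main.v *)
(** Put [N = s + t]. The set [M] consisting of the negative integers and of
    the first-column hook lengths of an [(s, t)]-core is closed under
    subtracting [s] and [t]. Call [p] a corner if [p] is not in [M] and
    [p - N] is; every class modulo [N] contains exactly one corner, and from a
    corner [p] one reaches the corner [p + s] if [p - t] is in [M], and the
    corner [p - t] otherwise. Following these steps [N] times is a closed walk
    through all corners, with [t] steps [+s] and [s] steps [-t]. Conversely
    every word in these steps comes from exactly one pair (core, corner), so
    the uniform distribution on cores is the image of that on words.
    If [p_k] are the corners, the size of the core is
    [Var(p) / 2 - (N^2 - 1) / 24], a quadratic function of the word.
    Over all words with [i] and [j] letters of the two kinds, the joint moments
    of the statistics occurring in it are polynomials in [i] and [j], which are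
    checked by induction on the last step of the word. *)

From Stdlib Require Import ZArith.
Require Import Defs.
From mathcomp Require Import all_boot all_order all_algebra finmap zify ssrZ.
From mathcomp Require Import boolp classical_sets functions cardinality.

Set Implicit Arguments.
Unset Strict Implicit.
Unset Printing Implicit Defensive.

Import Order.TTheory GRing.Theory Num.Theory.

Local Delimit Scope Z_scope with BZ.

Local Open Scope ring_scope.

(** * Moments of statistics of words *)

(** Here [j] counts the letters [false]; peeling off the head, which is the last step, yields a
    recurrence for moments. *)
Fixpoint words (n j : nat) : seq (seq bool) :=
  if n is n'.+1 then
    map (cons true) (words n' j) ++
    (if j is j'.+1 then map (cons false) (words n' j') else [::])
  else if j is 0 then [:: [::]] else [::].

Lemma mem_words n j w :
  (w \in words n j) = (size w == n) && (count negb w == j).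
Proof.
elim: n j w => [|n IH] [|j] [|x w] //=; rewrite mem_cat ?in_nil ?orbF.
- by apply/mapP => -[].
- case: x; first by rewrite mem_map ?IH // => u v [].
  by rewrite andbF; apply/mapP => -[].
- by apply/orP => -[] /mapP[].
- have inj b : injective (cons b : seq bool -> _) by move=> u v [].
  have no b (s : seq (seq bool)) : (~~ b :: w \in map (cons b) s) = false.
    by apply/mapP => -[v _ []]; case: b.
  case: x; first by rewrite (no false) orbF mem_map // IH.
  by rewrite (no true) mem_map // IH.
Qed.

Lemma words_uniq n j : uniq (words n j).
Proof.
have inj b : injective (cons b : seq bool -> _) by move=> u v [].
elim: n j => [|n IH] [|j] //=; first by rewrite cats0 map_inj_uniq.
rewrite cat_uniq !map_inj_uniq ?IH //= andbT.
by apply/hasPn => _ /mapP[v _ ->]; apply/mapP => -[].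
Qed.

Definition trues (w : seq bool) : Z := Z.of_nat (count id w).
Definition falses (w : seq bool) : Z := Z.of_nat (count negb w).

(* The head of a word is its last step; each sum is over the [true] steps,
   evaluated at the numbers of steps taken before. *)
Fixpoint path_sum (f : Z -> Z -> Z) (w : seq bool) : Z :=
  if w is x :: w' then
    Z.add (path_sum f w') (if x then f (trues w') (falses w') else Z0)
  else Z0.

Definition statA := path_sum Z.mul.
Definition statB := path_sum (fun _ j => Z.mul j j).
Definition statC := path_sum (fun _ j => j).

(* If [mu k] is the expectation of [X ^ k] then [shift e c mu] is that of
   [(X + e) ^ c]. *)
Fixpoint shift (e : Z) (c : nat) (mu : nat -> Z) : Z :=
  if c is c'.+1 then
    Z.add (shift e c' (fun k => mu k.+1)) (Z.mul e (shift e c' mu))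
  else mu 0%N.

Lemma eq_shift e c mu nu :
  (forall k, (k <= c)%N -> mu k = nu k) -> shift e c mu = shift e c nu.
Proof.
elim: c mu nu => [|c IH] mu nu h /=; first exact: h.
rewrite (IH mu nu) => [|k kc]; last by apply: h; exact: leqW.
by rewrite (IH _ (fun k => nu k.+1)) // => k kc; exact: h.
Qed.

Lemma shift_scale e c k mu :
  shift e c (fun x => (k * mu x)%BZ) = (k * shift e c mu)%BZ.
Proof. by elim: c mu => [|c IH] mu //=; rewrite !IH; ring. Qed.

(** The weight [f] is arbitrary so that the induction can absorb a factor [g] into it and shifts in
    several variables can be nested. *)
Lemma shift_sum (I : Type) (r : seq I) (f g : I -> Z) e c :
  shift e c (fun k => \sum_(w <- r) f w * g w ^+ k) =
  \sum_(w <- r) f w * (g w + e) ^+ c.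
Proof.
elim: c f => [|c IH] f //=.
have h k : \sum_(w <- r) f w * g w ^+ k.+1 =
           \sum_(w <- r) (f w * g w) * g w ^+ k.
  by apply: eq_bigr => w _; rewrite exprS mulrA.
rewrite (eq_shift _ (fun k _ => h k)) !IH.
transitivity (\sum_(w <- r) f w * g w * (g w + e) ^+ c +
              e * \sum_(w <- r) f w * (g w + e) ^+ c); first by [].
rewrite big_distrr -big_split /=; apply: eq_bigr => w _.
by rewrite [in RHS]exprS [RHS]mulrA mulrDr [RHS]mulrDl mulrA [e * _]mulrC.
Qed.

Definition moment a b c n j : Z :=
  \sum_(w <- words n j) statA w ^+ a * statB w ^+ b * statC w ^+ c.

Definition shift3 (e1 e2 e3 : Z) a b c (mu : nat -> nat -> nat -> Z) :=
  shift e1 a (fun x => shift e2 b (fun y => shift e3 c (mu x y))).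

Lemma eq_shift3 e1 e2 e3 a b c mu nu :
  (forall x y z, (x <= a)%N -> (y <= b)%N -> (z <= c)%N ->
     mu x y z = nu x y z) ->
  shift3 e1 e2 e3 a b c mu = shift3 e1 e2 e3 a b c nu.
Proof.
move=> h; apply: eq_shift => x xa; apply: eq_shift => y yb.
by apply: eq_shift => z zc; exact: h.
Qed.

Lemma shift3_scale e1 e2 e3 a b c k mu :
  shift3 e1 e2 e3 a b c (fun x y z => (k * mu x y z)%BZ) =
  (k * shift3 e1 e2 e3 a b c mu)%BZ.
Proof.
rewrite -shift_scale; apply: eq_shift => x _.
by rewrite -shift_scale; apply: eq_shift => y _; rewrite -shift_scale.
Qed.

Lemma shift3_moment e1 e2 e3 a b c n j :
  shift3 e1 e2 e3 a b c (fun x y z => moment x y z n j) =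
  \sum_(w <- words n j)
     (statA w + e1) ^+ a * (statB w + e2) ^+ b * (statC w + e3) ^+ c.
Proof.
have h3 x y : shift e3 c (fun z => moment x y z n j) =
    \sum_(w <- words n j) statA w ^+ x * (statC w + e3) ^+ c * statB w ^+ y.
  by rewrite shift_sum; apply: eq_bigr => w _; rewrite mulrAC.
have h2 x : shift e2 b (fun y => shift e3 c (fun z => moment x y z n j)) =
    \sum_(w <- words n j)
       (statC w + e3) ^+ c * (statB w + e2) ^+ b * statA w ^+ x.
  rewrite (eq_shift _ (fun y _ => h3 x y)) shift_sum.
  by apply: eq_bigr => w _; rewrite -mulrA mulrC.
rewrite /shift3 (eq_shift _ (fun x _ => h2 x)) shift_sum; apply: eq_bigr => w _.
by rewrite mulrC [_ ^+ c * _]mulrC mulrA.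
Qed.

(** Split by the last step: after [n - j] steps [true] and [j] steps [false], a step [true] adds
    [(n - j) j], [j ^ 2] and [j] to the three statistics, and a step [false] adds nothing. *)
Lemma momentS a b c n j :
  moment a b c n.+1 j =
  shift3 ((Z.of_nat n - Z.of_nat j) * Z.of_nat j)%BZ
    (Z.of_nat j * Z.of_nat j)%BZ (Z.of_nat j) a b c
    (fun x y z => moment x y z n j) +
  (if j is j'.+1 then moment a b c n j' else 0).
Proof.
rewrite shift3_moment /moment /= big_cat big_map /=; congr (_ + _).
  rewrite !big_seq; apply: eq_bigr => w; rewrite mem_words.
  move=> /andP[/eqP sw /eqP fw].
  rewrite /statA /statB /statC /= /falses fw.
  suff -> : trues w = (Z.of_nat n - Z.of_nat j)%BZ by [].
  have : (count id w + count negb w = size w)%N := count_predC id w.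
  by rewrite /trues; lia.
case: j => [|j]; rewrite ?big_nil // big_map; apply: eq_bigr => w _.
by rewrite /statA /statB /statC /= !Z.add_0_r.
Qed.

(* 60480 times the expectation of [statA ^ a * statB ^ b * statC ^ c] over the
   words with [i] letters [true] and [j] letters [false], for
   [2 a + 2 b + c <= 6]; found by interpolation. *)
Definition moment_poly (a b c : nat) (i j : Z) : Z :=
  match a, b, c with
  | 0, 0, 0 => (60480)%BZ
  | 0, 0, 1 => (30240*i*j)%BZ
  | 0, 0, 2 => (5040*i*j*(3*i*j + i + j + 1))%BZ
  | 0, 0, 3 => (7560*i^2*j^2*(i*j + i + j + 1))%BZ
  | 0, 0, 4 => (252*i*j*(15*i^3*j^3 + 30*i^3*j^2 + 30*i^2*j^3 + 5*i^3*j +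
    40*i^2*j^2 + 5*i*j^3 - 2*i^3 + 6*i^2*j + 6*i*j^2 - 2*j^3 - 4*i^2 - i*j -
    4*j^2 - 2*i - 2*j))%BZ
  | 0, 0, 5 => (630*i^2*j^2*(3*i^3*j^3 + 10*i^3*j^2 + 10*i^2*j^3 + 5*i^3*j +
    20*i^2*j^2 + 5*i*j^3 - 2*i^3 + 6*i^2*j + 6*i*j^2 - 2*j^3 - 4*i^2 - i*j -
    4*j^2 - 2*i - 2*j))%BZ
  | 0, 0, 6 => (15*i*j*(63*i^5*j^5 + 315*i^5*j^4 + 315*i^4*j^5 + 315*i^5*j^3 +
    945*i^4*j^4 + 315*i^3*j^5 - 91*i^5*j^2 + 483*i^4*j^3 + 483*i^3*j^4 -
    91*i^2*j^5 - 42*i^5*j - 273*i^4*j^2 - 21*i^3*j^3 - 273*i^2*j^4 - 42*i*j^5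
    + 16*i^5 - 78*i^4*j - 235*i^3*j^2 - 235*i^2*j^3 - 78*i*j^4 + 16*j^5 +
    48*i^4 - 6*i^3*j - 15*i^2*j^2 - 6*i*j^3 + 48*j^4 + 40*i^3 + 38*i^2*j +
    38*i*j^2 + 40*j^3 - 8*i - 8*j))%BZ
  | 0, 1, 0 => (10080*i*j*(2*j + 1))%BZ
  | 0, 1, 1 => (5040*i*j^2*(2*i*j + 2*i + j + 1))%BZ
  | 0, 1, 2 => (168*i*j*(30*i^2*j^3 + 55*i^2*j^2 + 40*i*j^3 + 9*i^2*j +
    51*i*j^2 + 2*j^3 - 4*i^2 + 5*i*j + 2*j^2 - 6*i - 2*j - 2))%BZ
  | 0, 1, 3 => (252*i*j^2*(10*i^3*j^3 + 30*i^3*j^2 + 25*i^2*j^3 + 14*i^3*j +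
    46*i^2*j^2 + 7*i*j^3 - 6*i^3 + 11*i^2*j + 8*i*j^2 - 2*j^3 - 10*i^2 - 3*i*j
    - 4*j^2 - 4*i - 2*j))%BZ
  | 0, 1, 4 => (6*i*j*(210*i^4*j^5 + 945*i^4*j^4 + 840*i^3*j^5 + 868*i^4*j^3 +
    2282*i^3*j^4 + 574*i^2*j^5 - 273*i^4*j^2 + 1008*i^3*j^3 + 819*i^2*j^4 -
    168*i*j^5 - 118*i^4*j - 722*i^3*j^2 - 156*i^2*j^3 - 422*i*j^4 - 16*j^5 +
    48*i^4 - 168*i^3*j - 479*i^2*j^2 - 296*i*j^3 - 24*j^4 + 120*i^3 + 2*i^2*j
    + 2*i*j^2 + 16*j^3 + 80*i^2 + 44*i*j + 32*j^2 - 8))%BZ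
  | 0, 2, 0 => (336*i*j*(20*i*j^3 + 36*i*j^2 + 16*j^3 + 7*i*j + 18*j^2 - 3*i -
    j - 3))%BZ
  | 0, 2, 1 => (168*i*j^2*(20*i^2*j^3 + 56*i^2*j^2 + 36*i*j^3 + 25*i^2*j +
    60*i*j^2 + 4*j^3 - 11*i^2 + 9*i*j + 4*j^2 - 15*i - 4*j - 4))%BZ
  | 0, 2, 2 => (4*i*j*(420*i^3*j^5 + 1736*i^3*j^4 + 1316*i^2*j^5 +
    1477*i^3*j^3 + 3234*i^2*j^4 + 546*i*j^5 - 494*i^3*j^2 + 1154*i^2*j^3 +
    700*i*j^4 - 122*j^5 - 205*i^3*j - 1146*i^2*j^2 - 319*i*j^3 - 270*j^4 +
    90*i^3 - 202*i^2*j - 538*i*j^2 - 152*j^3 + 180*i^2 + 25*i*j + 18*j^2 +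
    90*i + 22*j))%BZ
  | 0, 3, 0 => (8*i*j*(280*i^2*j^5 + 1092*i^2*j^4 + 672*i*j^5 + 886*i^2*j^3 +
    1476*i*j^4 + 128*j^5 - 297*i^2*j^2 + 348*i*j^3 + 132*j^4 - 131*i^2*j -
    621*i*j^2 - 154*j^3 + 60*i^2 - 75*i*j - 162*j^2 + 90*i + 26*j + 30))%BZ
  | 1, 0, 0 => (20160*i*j*(i - 1))%BZ
  | 1, 0, 1 => (2520*i*j*(4*i^2*j + i^2 - 3*i*j - j - 1))%BZ
  | 1, 0, 2 => (168*i*j*(30*i^3*j^2 + 25*i^3*j - 5*i^2*j^2 - i^3 - 3*i^2*j -
    27*i*j^2 - i^2 - 25*i*j + 2*j^2 + i + 3*j + 1))%BZ
  | 1, 0, 3 => (126*i*j*(20*i^4*j^3 + 35*i^4*j^2 + 15*i^3*j^3 + 3*i^4*j +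
    4*i^3*j^2 - 34*i^2*j^3 - 2*i^4 - i^3*j - 39*i^2*j^2 - 3*i*j^3 - 2*i^3 -
    5*i^2*j - 4*i*j^2 + 2*j^3 + 2*i^2 + i*j + 4*j^2 + 2*i + 2*j))%BZ
  | 1, 0, 4 => (12*i*j*(105*i^5*j^4 + 315*i^5*j^3 + 210*i^4*j^4 + 119*i^5*j^2
    + 217*i^4*j^3 - 217*i^3*j^4 - 63*i^5*j - 21*i^4*j^2 - 462*i^3*j^3 -
    168*i^2*j^4 + 4*i^5 - 52*i^4*j - 171*i^3*j^2 - 187*i^2*j^3 + 82*i*j^4 +
    6*i^4 + 74*i^3*j + 41*i^2*j^2 + 147*i*j^3 - 12*j^4 - 4*i^3 + 52*i^2*j +
    52*i*j^2 - 30*j^3 - 8*i^2 - 11*i*j - 20*j^2 + 2))%BZ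
  | 1, 1, 0 => (168*i*j*(40*i^2*j^2 + 36*i^2*j - 24*i*j^2 - i^2 - 21*i*j -
    16*j^2 - 15*j + 1))%BZ
  | 1, 1, 1 => (168*i*j*(20*i^3*j^3 + 33*i^3*j^2 + 3*i^2*j^3 + 3*i^3*j -
    8*i^2*j^2 - 24*i*j^3 - 2*i^3 - 3*i^2*j - 27*i*j^2 + j^3 - i^2 - 2*i*j +
    2*j^2 + 2*i + 2*j + 1))%BZ
  | 1, 1, 2 => (2*i*j*(840*i^4*j^4 + 2296*i^4*j^3 + 1036*i^3*j^4 + 819*i^4*j^2
    + 637*i^3*j^3 - 1638*i^2*j^4 - 457*i^4*j - 472*i^3*j^2 - 2866*i^2*j^3 -
    394*i*j^4 + 30*i^4 - 223*i^3*j - 741*i^2*j^2 - 349*i*j^3 + 156*j^4 +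
    30*i^3 + 487*i^2*j + 298*i*j^2 + 282*j^3 - 30*i^2 + 223*i*j + 96*j^2 -
    30*i - 30*j))%BZ
  | 1, 2, 0 => (8*i*j*(280*i^3*j^4 + 728*i^3*j^3 + 168*i^2*j^4 + 260*i^3*j^2 -
    90*i^2*j^3 - 448*i*j^4 - 143*i^3*j - 243*i^2*j^2 - 668*i*j^3 + 9*i^3 -
    27*i^2*j - 83*i*j^2 + 30*j^3 + 3*i^2 + 137*i*j + 66*j^2 - 9*i + 33*j -
    3))%BZ
  | 2, 0, 0 => (336*i*j*(20*i^3*j + 4*i^3 - 36*i^2*j - 3*i^2 + 13*i*j - 4*i +
    3*j + 3))%BZ
  | 2, 0, 1 => (168*i*j*(20*i^4*j^2 + 14*i^4*j - 26*i^3*j^2 - i^4 - 16*i^3*j -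
    9*i^2*j^2 - 11*i^2*j + 17*i*j^2 + 2*i^2 + 16*i*j - 2*j^2 - 3*j - 1))%BZ
  | 2, 0, 2 => (2*i*j*(840*i^5*j^3 + 1288*i^5*j^2 - 392*i^4*j^3 + 21*i^5*j -
    1344*i^4*j^2 - 1813*i^3*j^3 - 61*i^5 - 91*i^4*j - 1250*i^3*j^2 +
    1454*i^2*j^3 - 9*i^4 - 2*i^3*j + 1380*i^2*j^2 - 71*i*j^3 + 113*i^3 +
    109*i^2*j - 38*i*j^2 - 18*j^3 + 9*i^2 - 19*i*j - 36*j^2 - 52*i - 18*j))%BZ
  | 2, 1, 0 => (8*i*j*(280*i^4*j^3 + 420*i^4*j^2 - 280*i^3*j^3 + 14*i^4*j -
    564*i^3*j^2 - 298*i^2*j^3 - 21*i^4 - 44*i^3*j - 141*i^2*j^2 + 334*i*j^3 +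
    6*i^3 + 31*i^2*j + 339*i*j^2 - 36*j^3 + 30*i^2 + 26*i*j - 54*j^2 - 6*i -
    27*j - 9))%BZ
  | 3, 0, 0 => (8*i*j*(280*i^5*j^2 + 168*i^5*j - 672*i^4*j^2 - 16*i^5 -
    342*i^4*j + 346*i^3*j^2 + 15*i^4 + 51*i^3*j + 234*i^2*j^2 + 35*i^3 +
    306*i^2*j - 212*i*j^2 - 27*i^2 - 219*i*j + 24*j^2 - 19*i + 36*j + 12))%BZ
  | _, _, _ => 0%BZ
  end.

(* The last step of a random word is [true] with probability [i / (i + j)]. *)
Lemma moment_poly_rec a b c (i j : Z) : (a.*2 + b.*2 + c <= 6)%N ->
  (i * shift3 ((i - 1) * j) (j * j) j a b c
         (fun x y z => moment_poly x y z (i - 1) j)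
   + j * moment_poly a b c i (j - 1) = (i + j) * moment_poly a b c i j)%BZ.
Proof.
(* The weight bound leaves finitely many exponent triples, each a polynomial identity in [i] and
   [j]. *)
do 4?[case: a => [|a]]; do 4?[case: b => [|b]]; do 7?[case: c => [|c]];
  rewrite // => _; cbn [shift3 shift moment_poly]; ring.
Qed.

(** Induction on the length through [momentS] and [moment_poly_rec]. The binomial coefficients match
    by absorption: [(n + 1) C(n, j) = (n + 1 - j) C(n + 1, j)] and
    [(n + 1) C(n, j - 1) = j C(n + 1, j)]. *)
Lemma momentE a b c n j : (a.*2 + b.*2 + c <= 6)%N ->
  (60480 * moment a b c n j =
   Z.of_nat 'C(n, j) * moment_poly a b c (Z.of_nat n - Z.of_nat j)
                                   (Z.of_nat j))%BZ.
Proof.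
elim: n j a b c => [|n IH] j a b c abc.
  case: j => [|j].
    rewrite /moment /= big_seq1 /statA /statB /statC /=.
    move: abc; do 4?[case: a => [|a]]; do 4?[case: b => [|b]];
      do 7?[case: c => [|c]]; rewrite // => _;
      by rewrite ?expr0 ?exprS ?mul0r ?mulr0.
  by rewrite /moment /= big_nil.
apply: (@Z.mul_reg_l _ _ (Z.of_nat n.+1)) => //.
rewrite momentS.
set e1 := ((Z.of_nat n - _) * _)%BZ; set e2 := (Z.of_nat j * Z.of_nat j)%BZ.
set S := shift3 _ _ _ _ _ _ _.
have SE : (60480 * S = Z.of_nat 'C(n, j) * shift3 e1 e2 (Z.of_nat j) a b c
   (fun x y z => moment_poly x y z (Z.of_nat n - Z.of_nat j) (Z.of_nat j)))%BZ.
  rewrite /S -!shift3_scale; apply: eq_shift3 => x y z xa yb zc.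
  by apply: IH; lia.
have R := moment_poly_rec (Z.of_nat n.+1 - Z.of_nat j) (Z.of_nat j) abc.
have E1 : (Z.of_nat n.+1 - Z.of_nat j - 1 = Z.of_nat n - Z.of_nat j)%BZ by lia.
rewrite E1 -/e1 -/e2 in R.
set S' := shift3 _ _ _ _ _ _ _ in SE R.
have B1 : (Z.of_nat n.+1 * Z.of_nat 'C(n, j) =
           (Z.of_nat n.+1 - Z.of_nat j) * Z.of_nat 'C(n.+1, j))%BZ.
  have := mul_bin_down n.+1 j; rewrite [n.+1.-1]/=.
  have [jn|jn] := leqP j n.+1; first by nia.
  by rewrite !bin_small //; lia.
clearbody S S'; clear e1 e2 E1.
set m := (if j is _.+1 then _ else _).
set p := moment_poly a b c _ (Z.of_nat j - 1) in R.
have mE : (Z.of_nat n.+1 * (60480 * m) =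
           Z.of_nat j * Z.of_nat 'C(n.+1, j) * p)%BZ.
  rewrite /m /p; case: j {B1 SE R m p} => [|j]; first by rewrite Z.mul_0_r.
  rewrite (IH j _ _ _ abc).
  have -> : (Z.of_nat j.+1 - 1 = Z.of_nat j)%BZ by lia.
  have -> : (Z.of_nat n.+1 - Z.of_nat j.+1 = Z.of_nat n - Z.of_nat j)%BZ by lia.
  rewrite Z.mul_assoc; congr Z.mul.
  by have := mul_bin_diag n.+1 j; rewrite [n.+1.-1]/=; lia.
rewrite -[(S + m)%R]/(S + m)%BZ.
transitivity (Z.of_nat n.+1 * (60480 * S) + Z.of_nat n.+1 * (60480 * m))%BZ.
  by ring.
rewrite SE mE Z.mul_assoc B1.
transitivity (Z.of_nat 'C(n.+1, j) *
  ((Z.of_nat n.+1 - Z.of_nat j) * S' + Z.of_nat j * p))%BZ; first by ring.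
by rewrite R; ring.
Qed.

(** * Mean and third moment of the deviation over words *)

Definition dev_op (i j : Z) (mu : nat -> nat -> nat -> Z) a b c : Z :=
  (12 * i * mu a b.+1 c - 24 * j * mu a.+1 b c + 12 * j * (i - 1) * mu a b c.+1
   - 12 * mu a b c.+2 + i * j * (i - 1) * (j - 1) * mu a b c)%BZ.

(* 24 times the deviation of the size from its mean
   [(s - 1)(t - 1)(s + t + 1) / 24], for words with [i = t] and [j = s]. *)
Definition dev (i j : Z) (w : seq bool) : Z :=
  (12 * i * statB w - 24 * j * statA w + 12 * j * (i - 1) * statC w
   - 12 * (statC w * statC w) + i * j * (i - 1) * (j - 1))%BZ.

(** On moments, [dev_op] is the effect of multiplying each summand by [dev]; the weight [f] lets
    this be iterated. *)
Lemma dev_op_sum (i j : Z) (r : seq (seq bool)) (f : seq bool -> Z) a b c :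
  dev_op i j (fun a b c => \sum_(w <- r)
     f w * (statA w ^+ a * statB w ^+ b * statC w ^+ c)) a b c =
  \sum_(w <- r) (f w * dev i j w) *
     (statA w ^+ a * statB w ^+ b * statC w ^+ c).
Proof.
elim: r => [|w r IH]; first by rewrite /dev_op !big_nil -[0%R]/Z0; ring.
rewrite [RHS]big_cons -IH /dev_op !big_cons /dev !exprS.
set x1 := statA w ^+ a; set x2 := statB w ^+ b; set x3 := statC w ^+ c.
have key (A B C y s1 s2 s3 s4 s5 : Z) :
  (12 * i * (y * (x1 * (B * x2) * x3) + s1)
   - 24 * j * (y * (A * x1 * x2 * x3) + s2)
   + 12 * j * (i - 1) * (y * (x1 * x2 * (C * x3)) + s3)
   - 12 * (y * (x1 * x2 * (C * (C * x3))) + s4)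
   + i * j * (i - 1) * (j - 1) * (y * (x1 * x2 * x3) + s5)
   = y * (12 * i * B - 24 * j * A + 12 * j * (i - 1) * C - 12 * (C * C)
       + i * j * (i - 1) * (j - 1)) * (x1 * x2 * x3) +
     (12 * i * s1 - 24 * j * s2 + 12 * j * (i - 1) * s3 - 12 * s4
       + i * j * (i - 1) * (j - 1) * s5))%BZ by ring.
by apply: key.
Qed.

(** Multiplication by [dev] raises the weight [2 a + 2 b + c] by at most 2, so a cube needs moments
    up to weight 6, the range of [moment_poly]. *)
Lemma eq_dev_op i j mu nu k :
  (forall a b c, (a.*2 + b.*2 + c <= k.+2)%N -> mu a b c = nu a b c) ->
  forall a b c, (a.*2 + b.*2 + c <= k)%N ->
    dev_op i j mu a b c = dev_op i j nu a b c.
Proof. by move=> h a b c abc; rewrite /dev_op !h //; lia. Qed.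

Lemma dev_op_scale i j k mu a b c :
  dev_op i j (fun a b c => (k * mu a b c)%BZ) a b c =
  (k * dev_op i j mu a b c)%BZ.
Proof. by rewrite /dev_op; ring. Qed.

Lemma sum_dev_op i j n k :
  \sum_(w <- words n k) dev i j w =
  dev_op i j (fun a b c => moment a b c n k) 0 0 0.
Proof.
transitivity (\sum_(w <- words n k) (1 * dev i j w) *
     (statA w ^+ 0 * statB w ^+ 0 * statC w ^+ 0)).
  by apply: eq_bigr => w _; rewrite mul1r !mulr1.
rewrite -dev_op_sum; apply: (@eq_dev_op _ _ _ _ 0) => // a b c _.
by apply: eq_bigr => w _; rewrite mul1r.
Qed.

Lemma sum_dev3_op i j n k :
  \sum_(w <- words n k) dev i j w ^+ 3 =
  dev_op i j (dev_op i j (dev_op i j (fun a b c => moment a b c n k))) 0 0 0.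
Proof.
transitivity (\sum_(w <- words n k) (dev i j w * dev i j w * dev i j w) *
     (statA w ^+ 0 * statB w ^+ 0 * statC w ^+ 0)).
  by apply: eq_bigr => w _; rewrite !mulr1 exprS expr2 mulrA.
rewrite -dev_op_sum; apply: (@eq_dev_op _ _ _ _ 0) => // a b c abc.
rewrite -dev_op_sum; apply: (@eq_dev_op _ _ _ _ 2) => // {a b c abc}a b c abc.
transitivity (\sum_(w <- words n k) (1 * dev i j w) *
     (statA w ^+ a * statB w ^+ b * statC w ^+ c)).
  by apply: eq_bigr => w _; rewrite mul1r.
rewrite -dev_op_sum; apply: (@eq_dev_op _ _ _ _ 4) => // {a b c abc}a b c abc.
by apply: eq_bigr => w _; rewrite mul1r.
Qed.

Section DevMoments.

Variables n k : nat.
Let i := (Z.of_nat n - Z.of_nat k)%BZ.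
Let j := Z.of_nat k.

Lemma sum_dev : \sum_(w <- words n k) dev i j w = 0.
Proof.
apply: (@Z.mul_reg_l _ _ 60480) => //; rewrite sum_dev_op -dev_op_scale.
rewrite (@eq_dev_op _ _ _ (fun a b c => (Z.of_nat 'C(n, k) *
   moment_poly a b c i j)%BZ) 0) // => [|a b c abc]; last first.
  by apply: momentE; lia.
by rewrite dev_op_scale -[0%R]/Z0 /dev_op /moment_poly; ring.
Qed.

(** The factor [8 / 35] is [24 ^ 3 / 60480], since [dev] is 24 times a deviation of the size. *)
Lemma sum_dev3 :
  (35 * (\sum_(w <- words n k) dev i j w ^+ 3)%R =
   8 * Z.of_nat 'C(n, k) * (j * i * (i - 1) * (j - 1) * (j + i + 1) * (j + i) *
     (2 * j ^ 2 * i + 2 * j * i ^ 2 - 3 * j ^ 2 - 3 * j * i - 3 * i ^ 2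
      - 3)))%BZ.
Proof.
apply: (@Z.mul_reg_l _ _ 60480) => //; rewrite sum_dev3_op.
rewrite Z.mul_assoc (Z.mul_comm _ 35) -Z.mul_assoc.
rewrite -dev_op_scale.
rewrite (@eq_dev_op _ _ _ (dev_op i j (dev_op i j (fun a b c =>
  (Z.of_nat 'C(n, k) * moment_poly a b c i j)%BZ))) 0) // => [|a b c abc].
  rewrite /dev_op /moment_poly; ring.
rewrite -dev_op_scale; apply: (@eq_dev_op _ _ _ _ 2) => // {a b c abc}a b c abc.
rewrite -dev_op_scale; apply: (@eq_dev_op _ _ _ _ 4) => // {a b c abc}a b c abc.
exact: momentE.
Qed.

End DevMoments.

(** * Ideals and their corners *)

Lemma trues_falses w : (trues w + falses w = Z.of_nat (size w))%BZ.
Proof.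
have : (count id w + count negb w = size w)%N := count_predC id w.
by rewrite /trues /falses; lia.
Qed.

Section Ideals.

Variables s t : nat.

Let S := Z.of_nat s.
Let T := Z.of_nat t.
Let N := (S + T)%BZ.

(** The last two conditions fix the translation: the least integer outside [M] is 0. *)
Definition ideal (M : Z -> bool) : Prop :=
  [/\ forall m, M m -> M (m - S)%BZ, forall m, M m -> M (m - T)%BZ,
      forall m, (m < 0)%BZ -> M m & ~~ M 0%BZ].

Definition corner (M : Z -> bool) (p : Z) : bool := ~~ M p && M (p - N)%BZ.

Definition next (M : Z -> bool) (p : Z) : Z :=
  if M (p - T)%BZ then (p + S)%BZ else (p - T)%BZ.

Fixpoint trace (M : Z -> bool) (p : Z) (n : nat) : seq bool :=
  if n is n'.+1 then M (iter n' (next M) p - T)%BZ :: trace M p n' else [::].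

Definition disp (w : seq bool) : Z := (S * trues w - T * falses w)%BZ.

(** The positions before each step, relative to the start; the end is left out since a closed walk
    returns to the start. *)
Fixpoint points (w : seq bool) : seq Z :=
  if w is _ :: w' then disp w' :: points w' else [::].

Lemma size_trace M p n : size (trace M p n) = n.
Proof. by elim: n => //= n ->. Qed.

Lemma size_points w : size (points w) = size w.
Proof. by elim: w => //= x w ->. Qed.

Lemma disp_cons x w : disp (x :: w) = (disp w + if x then S else - T)%BZ.
Proof. by rewrite /disp /trues /falses; case: x => /=; lia. Qed.

Lemma iter_next M p n :
  iter n (next M) p = (p + disp (trace M p n))%BZ.
Proof.
elim: n => [|n IH] /=; first by rewrite /disp /trues /falses /=; lia.
by rewrite disp_cons {1}/next; case: ifP => _; rewrite IH; lia.
Qed.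

(** Modulo [N] a step [-t] equals a step [+s], so the class reached depends only on the number of
    steps. *)
Lemma disp_mod w : exists c, disp w = (Z.of_nat (size w) * S + c * N)%BZ.
Proof.
exists (- falses w)%BZ; rewrite -trues_falses /disp /N; ring.
Qed.

Lemma iter_mod M p n : exists c,
  iter n (next M) p = (p + Z.of_nat n * S + c * N)%BZ.
Proof.
have [c e] := disp_mod (trace M p n); exists c.
by rewrite iter_next e size_trace; lia.
Qed.

Lemma mem_points_trace M p n x :
  (x \in points (trace M p n)) =
  [exists k : 'I_n, (iter k (next M) p == p + x)%BZ].
Proof.
elim: n => [|n IH] /=; first by rewrite in_nil; apply/esym/existsP => -[[]].
rewrite in_cons IH; apply/orP/existsP => [[/eqP ->|/existsP[k kE]]|[k]].
- by exists ord_max; rewrite /= iter_next.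
- by exists (widen_ord (leqnSn n) k).
- have [kn|kn] := ltnP k n.
    by move=> h; right; apply/existsP; exists (Ordinal kn).
  have -> : k = n :> nat by have := ltn_ord k; lia.
  by rewrite iter_next => /eqP h; left; apply/eqP; lia.
Qed.

Hypotheses (s0 : (0 < s)%N) (t0 : (0 < t)%N) (st : coprime s t).

(** Since [gcd(s, s + t) = gcd(s, t) = 1], the multiples of [s] run through all classes modulo
    [N]. *)
Lemma exists_inverse : exists u v, (u * S = v * N + 1)%BZ.
Proof.
have [u v e _] := egcdnP (s + t) s0; exists (Z.of_nat u), (Z.of_nat v).
move: e; rewrite gcdnDl => e.
move: st e; rewrite /coprime => /eqP ->; rewrite /N /S /T; lia.
Qed.

Lemma class_index m :
  exists2 k : nat, (k < s + t)%N & exists c, (Z.of_nat k * S = m + c * N)%BZ.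
Proof.
have [u [v e]] := exists_inverse.
have N0 : (0 < N)%BZ by rewrite /N /S /T; lia.
exists (Z.to_nat ((u * m) mod N)).
  have := Z.mod_pos_bound (u * m) N N0; rewrite /N /S /T; lia.
rewrite Z2Nat.id; last by have := Z.mod_pos_bound (u * m) N N0; lia.
exists (v * m - S * (u * m / N))%BZ.
have -> : ((u * m) mod N = u * m - N * (u * m / N))%BZ.
  by have := Z.div_mod (u * m) N; lia.
transitivity (u * S * m - N * S * (u * m / N))%BZ; first by ring.
by rewrite e; ring.
Qed.

Lemma class_index_inj (k k' : nat) c : (k < s + t)%N -> (k' < s + t)%N ->
  (Z.of_nat k * S = Z.of_nat k' * S + c * N)%BZ -> k = k'.
Proof.
move=> kN kN' e; have [u [v uE]] := exists_inverse.
have h : (Z.of_nat k - Z.of_nat k' =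
          N * (u * c - v * (Z.of_nat k - Z.of_nat k')))%BZ.
  transitivity ((Z.of_nat k - Z.of_nat k') * (u * S - v * N))%BZ.
    by rewrite uE; ring.
  transitivity (u * (Z.of_nat k * S - Z.of_nat k' * S) -
    v * N * (Z.of_nat k - Z.of_nat k'))%BZ; first by ring.
  by rewrite e; ring.
move: (u * c - _)%BZ h => d h.
have : (- N < N * d < N)%BZ by rewrite -h /N /S /T; lia.
have N0 : (0 < N)%BZ by rewrite /N /S /T; lia.
move=> ?; have d0 : d = 0%BZ by nia.
by move: h; rewrite d0; lia.
Qed.

Section OneIdeal.

Variables (M : Z -> bool) (idM : ideal M).

Lemma idealB m (c : nat) : M m -> M (m - Z.of_nat c * N)%BZ.
Proof.
have [hS hT _ _] := idM; move=> Mm; elim: c => [|c IH].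
  by have -> : (m - Z.of_nat 0 * N = m)%BZ by lia.
have -> : (m - Z.of_nat c.+1 * N = m - Z.of_nat c * N - S - T)%BZ.
  by rewrite /N; lia.
by apply: hT; apply: hS.
Qed.

(** Being closed under subtraction of [N], the ideal is a lower ray in each class modulo [N], and
    the corner is the first point missing from it. *)
Lemma idealE p m c : corner M p -> (m = p + c * N)%BZ -> M m = (m <? p)%BZ.
Proof.
move=> /andP[pM pN] mE.
have N0 : (0 < N)%BZ by rewrite /N /S /T; lia.
have [mp|mp] := Z.ltb_spec m p.
  have -> : (m = p - N - Z.of_nat (Z.to_nat (- c - 1)) * N)%BZ.
    rewrite Z2Nat.id; nia.
  exact: idealB.
apply: contraNF pM => Mm.
have -> : (p = m - Z.of_nat (Z.to_nat c) * N)%BZ.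
  rewrite Z2Nat.id; nia.
exact: idealB.
Qed.

Lemma corner_inj p q c :
  corner M p -> corner M q -> (p = q + c * N)%BZ -> p = q.
Proof.
move=> cp cq e; have := idealE cq e; have := @idealE p q (- c)%BZ cp.
case/andP: cp cq => /negbTE -> _ /andP[/negbTE -> _] h1 h2.
have := h1 ltac:(lia); lia.
Qed.

Lemma corner0 : corner M 0.
Proof.
have [_ _ hn h0] := idM; rewrite /corner h0; apply: hn.
by rewrite /N /S /T; lia.
Qed.

Lemma corner_ge0 p : corner M p -> (0 <= p)%BZ.
Proof.
case/andP => pM _; have [_ _ hn _] := idM.
have [//|/hn h] := Z.le_gt_cases 0 p; by rewrite h in pM.
Qed.

(** If [p - t] is in [M], then [p + s] is outside because [p] is, and [p + s - N = p - t]; otherwise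
    [p - t - N] is in [M] because [p - N] is. *)
Lemma corner_next p : corner M p -> corner M (next M p).
Proof.
have [hS hT _ _] := idM; case/andP => pM pN; rewrite /next /corner.
case: ifP => [h|/negbT h].
  have -> : (p + S - N = p - T)%BZ by rewrite /N; lia.
  rewrite h andbT; apply: contra pM => /hS.
  by have -> : (p + S - S = p)%BZ by lia.
rewrite h; have -> : (p - T - N = p - N - T)%BZ by lia.
exact: hT.
Qed.

Lemma corner_iter p n : corner M p -> corner M (iter n (next M) p).
Proof. by move=> cp; elim: n => //= n; exact: corner_next. Qed.

(** After [N] steps the walk is back in the class of [p], which has only one corner. *)
Lemma corner_period p : corner M p -> iter (s + t) (next M) p = p.
Proof.
move=> cp; have [c e] := iter_mod M p (s + t).
apply: (@corner_inj _ _ (S + c)%BZ) => //; first exact: corner_iter.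
by rewrite e /N /S /T; lia.
Qed.

Lemma corner_iterP p q : corner M p -> corner M q ->
  exists2 k, (k < s + t)%N & iter k (next M) p = q.
Proof.
move=> cp cq; have [k kN [c e]] := class_index (q - p)%BZ; exists k => //.
have [c' e'] := iter_mod M p k.
by apply: (@corner_inj _ _ (c + c')%BZ) => //; [exact: corner_iter | lia].
Qed.

Lemma iter_next_inj p k k' : (k < s + t)%N -> (k' < s + t)%N ->
  iter k (next M) p = iter k' (next M) p -> k = k'.
Proof.
move=> kN kN' e; have [c ec] := iter_mod M p k.
have [c' ec'] := iter_mod M p k'.
by apply: (@class_index_inj _ _ (c' - c)%BZ) => //; lia.
Qed.

Lemma trace_words p : corner M p -> trace M p (s + t) \in words (s + t) s.
Proof.
move=> cp; rewrite mem_words size_trace eqxx /=.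
have := corner_period cp; rewrite iter_next => e.
have := trues_falses (trace M p (s + t)); rewrite size_trace => e'.
(* A closed walk has [s * trues = t * falses]; with [N] steps in all, only [falses = s] is
   possible. *)
have : (N * (falses (trace M p (s + t)) - S) = 0)%BZ.
  move: e e'; rewrite /disp.
  move: (trues _) (falses _) => x y; rewrite /N /S /T; nia.
rewrite /falses => /Z.mul_eq_0; rewrite /N /S /T => -[]; lia.
Qed.

Lemma mem_points p q : corner M p ->
  ((q \in points (trace M p (s + t))) = corner M (p + q)%BZ).
Proof.
move=> cp; rewrite mem_points_trace; apply/existsP/idP.
  by move=> [k /eqP <-]; exact: corner_iter.
by move=> /(corner_iterP cp)[k kN kE]; exists (Ordinal kN); apply/eqP.
Qed.

Lemma points_uniq p : uniq (points (trace M p (s + t))).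
Proof.
have: (s + t <= s + t)%N by [].
(* The induction is on the length of the trace, with the bound [s + t] kept fixed. *)
elim: {1 3}(s + t)%N => //= n IH nN; rewrite IH ?andbT; last exact: ltnW.
rewrite mem_points_trace; apply/existsP => -[k].
rewrite -iter_next => /eqP /iter_next_inj.
have kn := ltn_ord k; move=> /(_ (ltn_trans kn nN) nN); lia.
Qed.

End OneIdeal.

Lemma corner_eq M M' : ideal M -> ideal M' -> corner M =1 corner M' -> M =1 M'.
Proof.
move=> iM iM' h m; have [k _ [c e]] := class_index m.
have cq := corner_iter iM k (corner0 iM).
have [c' e'] := iter_mod M 0%BZ k.
have eq : (m = iter k (next M) 0 + (- c - c') * N)%BZ by lia.
by rewrite (idealE iM cq eq) (idealE iM' _ eq) // -h.
Qed.

(* The corners determine the ideal, and their minimum is 0. *)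
Lemma trace_inj M M' p p' : ideal M -> ideal M' -> corner M p -> corner M' p' ->
  trace M p (s + t) = trace M' p' (s + t) -> p = p' /\ M =1 M'.
Proof.
move=> iM iM' cp cp' e.
have h1 x := mem_points iM x cp; have h2 x := mem_points iM' x cp'.
have h x : corner M (p + x)%BZ = corner M' (p' + x)%BZ by rewrite -h1 e h2.
have pp : p = p'.
  have := h (- p)%BZ; rewrite Z.add_opp_diag_r (corner0 iM).
  move=> /esym/(corner_ge0 iM').
  have := h (- p')%BZ; rewrite Z.add_opp_diag_r (corner0 iM').
  move=> /(corner_ge0 iM).
  lia.
split=> //; apply: corner_eq => // x.
have -> : (x = p + (x - p))%BZ by lia.
by rewrite h pp.
Qed.

End Ideals.

(** * From words to ideals *)

Lemma seq_min (l : seq Z) : l != [::] ->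
  exists2 x, x \in l & forall y, y \in l -> (x <= y)%BZ.
Proof.
elim: l => // a l IH _; case: (eqVneq l [::]) => [->|/IH[x xl xmin]].
  by exists a; rewrite ?mem_head // => y; rewrite inE => /eqP ->; lia.
have [ax|ax] := Z.le_gt_cases a x.
  exists a; rewrite ?mem_head // => y; rewrite in_cons => /orP[/eqP ->|/xmin].
    by lia.
  by lia.
exists x; rewrite ?in_cons ?xl ?orbT // => y /orP[/eqP ->|/xmin //]; lia.
Qed.

Section IdealOfWord.

Variables s t : nat.
Hypotheses (s0 : (0 < s)%N) (t0 : (0 < t)%N) (st : coprime s t).

Let S := Z.of_nat s.
Let T := Z.of_nat t.
Let N := (S + T)%BZ.

Notation disp := (disp s t).
Notation points := (points s t).

Lemma pointsP w x :
  reflect (exists u b v, w = u ++ b :: v /\ x = disp v) (x \in points w).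
Proof.
apply: (iffP idP).
  elim: w => //= a w IH; rewrite in_cons => /orP[/eqP ->|/IH].
    by exists [::], a, w.
  by move=> [u [b [v [-> ->]]]]; exists (a :: u), b, v.
move=> [u [b [v [-> ->]]]]; elim: u => [|a u IH] /=; first exact: mem_head.
by rewrite in_cons IH orbT.
Qed.

Variable w : seq bool.
Hypothesis ww : w \in words (s + t) s.

Lemma size_word : size w = (s + t)%N.
Proof. by move: ww; rewrite mem_words => /andP[/eqP]. Qed.

Lemma falses_word : falses w = S.
Proof. by move: ww; rewrite mem_words /falses => /andP[_ /eqP ->]. Qed.

Lemma trues_word : trues w = T.
Proof.
by have := trues_falses w; rewrite size_word falses_word /S /T; lia.
Qed.

Lemma disp_word : disp w = 0%BZ.
Proof. by rewrite /disp trues_word falses_word -/S -/T; lia. Qed.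

Lemma points0 : 0%BZ \in points w.
Proof.
have := size_word; case/lastP: w => [|u b] sz; first by rewrite /= in sz; lia.
apply/pointsP; exists u, b, [::]; rewrite cats1; split=> //.
by rewrite /disp /trues /falses /=; lia.
Qed.

(** The class of a point determines the length of its suffix, which is below [N], and hence the
    suffix itself. *)
Lemma points_inj x y c : x \in points w -> y \in points w ->
  (x = y + c * N)%BZ -> x = y.
Proof.
move=> /pointsP[u [b [v [wE ->]]]] /pointsP[u' [b' [v' [wE' ->]]]] e.
have sv : size v = size v'.
  have [d ed] := disp_mod s t v; have [d' ed'] := disp_mod s t v'.
  have := size_word; rewrite {1}wE size_cat /= => sz.
  have := size_word; rewrite {1}wE' size_cat /= => sz'.
  apply: (@class_index_inj s t s0 t0 st _ _ (c + d' - d)%BZ); lia.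
have : u ++ b :: v == u' ++ b' :: v' by rewrite -wE -wE'.
rewrite -!cat_rcons eqseq_cat => [/andP[_ /eqP -> //]|].
have := size_word; rewrite {1}wE size_cat /= => sz.
have := size_word; rewrite {1}wE' size_cat /= => sz'.
by rewrite !size_rcons; lia.
Qed.

Lemma points_class m : exists2 x, x \in points w & exists c, (m = x + c * N)%BZ.
Proof.
have [k kN [c e]] := class_index s0 t0 st m.
have kw : (size w - k.+1 < size w)%N by rewrite size_word; lia.
exists (disp (drop (size w - k) w)).
  apply/pointsP; exists (take (size w - k.+1) w), (nth true w (size w - k.+1)),
    (drop (size w - k) w); split=> //.
  have -> : (size w - k = (size w - k.+1).+1)%N by rewrite size_word; lia.
  by rewrite -drop_nth // cat_take_drop.
have [d ed] := disp_mod s t (drop (size w - k) w); exists (- c - d)%BZ.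
rewrite ed size_drop.
have -> : (size w - (size w - k) = k)%N by rewrite size_word; lia.
by rewrite e /N /S /T; lia.
Qed.

Lemma points_pred x : x \in points w ->
  exists2 y, y \in points w & x = (y + S)%BZ \/ x = (y - T)%BZ.
Proof.
have step b v :
    disp (b :: v) = (disp v + S)%BZ \/ disp (b :: v) = (disp v - T)%BZ.
  by rewrite disp_cons; case: b; [left|right]; rewrite /S /T; lia.
move=> /pointsP[u [b [[|b' v] [wE ->]]]].
  (* The walk is closed, so the start is preceded by the last position. *)
  have -> : disp [::] = disp w.
    by rewrite disp_word /disp /trues /falses /=; lia.
  have : size w <> 0%N by rewrite size_word; lia.
  case: w (pointsP w) => // b' v h _; exists (disp v) => //.
  by apply/h; exists [::], b', v.
exists (disp v) => //; apply/pointsP; exists (rcons u b), b', v.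
by rewrite cat_rcons.
Qed.

Lemma points_succ u b v : w = u ++ b :: v -> disp (b :: v) \in points w.
Proof.
case/lastP: u => [|u b'] wE.
  by rewrite -[b :: v]cat0s -wE disp_word points0.
by apply/pointsP; exists u, b', (b :: v); rewrite wE cat_rcons.
Qed.

(** In each class modulo [N] this takes everything below [p + x], where [x] is the point of the word
    in the class of [m - p]; the translated points become the corners. *)
Definition word_ideal (p m : Z) : bool :=
  has (fun x => (m <? p + x)%BZ && ((m - p - x) mod N =? 0)%BZ) (points w).

Lemma word_idealE p m x c : x \in points w -> (m = p + x + c * N)%BZ ->
  word_ideal p m = (m <? p + x)%BZ.
Proof.
move=> xw mE; have N0 : N <> 0%BZ by rewrite /N /S /T; lia.
apply/hasP/idP => [[y yw /andP[my /Z.eqb_eq]]|mx].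
  move=> /(Z.div_exact _ _ N0) e.
  rewrite (points_inj xw yw (_ : _ = _ + ((m - p - y) / N - c) * N)%BZ) //.
  by lia.
exists x => //; rewrite mx; apply/Z.eqb_eq.
have -> : (m - p - x = c * N)%BZ by lia.
exact: Z.mod_mul.
Qed.

Lemma word_idealP : exists M p, [/\ ideal s t M, corner s t M p,
  trace s t M p (s + t) = w & exists b, forall m, M m -> (m < b)%BZ].
Proof.
have N0 : (0 < N)%BZ by rewrite /N /S /T; lia.
have pw : points w != [::] by case: (points w) points0.
have [x0 x0w x0min] := seq_min pw.
(* This translation moves the smallest point to 0, as [ideal] demands. *)
pose p := (- x0)%BZ; exists (word_ideal p), p.
have cl m : exists2 x, x \in points w & exists c, (m = p + x + c * N)%BZ.
  have [x xw [c e]] := points_class (m - p)%BZ; exists x => //; exists c; lia.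
split.
- split=> [m|m|m m0|].
  + have [x xw [c e]] := cl m; rewrite (word_idealE xw e) => /Z.ltb_lt mx.
    (* Subtracting [s] leads to the class of the preceding point, whose bound is lower by [s] or
       higher by [t]. Subtracting [t] leads likewise to the following point. *)
    have [y yw [xy|xy]] := points_pred xw.
      by rewrite (word_idealE yw (_ : _ = _ + c * N)%BZ) -/S; lia.
    rewrite (word_idealE yw (_ : _ = _ + (c - 1) * N)%BZ) -/S /N in N0 *;
      by lia.
  + have [x xw [c e]] := cl m; rewrite (word_idealE xw e) => /Z.ltb_lt mx.
    have /pointsP[u [b [v [wE xE]]]] := xw.
    have := points_succ wE; rewrite disp_cons -xE -/S -/T; case: b {wE} => yw.
      rewrite (word_idealE yw (_ : _ = _ + (c - 1) * N)%BZ) -/T /N in N0 *;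
        by lia.
    by rewrite (word_idealE yw (_ : _ = _ + c * N)%BZ) -/T; lia.
  + have [x xw [c e]] := cl m; rewrite (word_idealE xw e).
    by apply/Z.ltb_lt; have := x0min _ xw; rewrite /p; lia.
  + rewrite (word_idealE x0w (_ : _ = _ + 0 * N)%BZ); rewrite /p; lia.
- rewrite /corner (word_idealE points0 (_ : _ = _ + 0 * N)%BZ); last by lia.
  rewrite (word_idealE points0 (_ : _ = _ + (- 1) * N)%BZ) /N -/S -/T;
    last by lia.
  by rewrite /N in N0; lia.
(* Suffixes are rebuilt letter by letter: from [x] the next point is [x + s] or [x - t], and
   [p + x - t] is in the ideal exactly in the first case. *)
- suff h u v : w = u ++ v -> trace s t (word_ideal p) p (size v) = v.
    by rewrite -size_word; exact: (h [::]).
  elim: v u => //= b v IH u wE.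
  have := IH (rcons u b); rewrite cat_rcons => /(_ wE) tv.
  rewrite iter_next tv; congr cons.
  have := points_succ wE; rewrite disp_cons -/S -/T.
  case: b {wE} => yw.
    by rewrite (word_idealE yw (_ : _ = _ + (- 1) * N)%BZ) /N -/T in N0 *; lia.
  by rewrite (word_idealE yw (_ : _ = _ + 0 * N)%BZ) -/T; lia.
- have pw' : map Z.opp (points w) != [::] by case: (points w) pw.
  have [y _ ymin] := seq_min pw'.
  exists (p - y + 1)%BZ => m /hasP[x xw /andP[/Z.ltb_lt mx _]].
  by have := ymin _ (map_f Z.opp xw); lia.
Qed.

End IdealOfWord.

(** * Beta sets *)

Definition betas (la : intpart) : seq nat :=
  [seq beta la i | i <- iota 1 (size la)].

Implicit Types la : intpart.

Lemma size_betas la : size (betas la) = size la.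
Proof. by rewrite size_map size_iota. Qed.

Lemma nth_betas la i : (i < size la)%N ->
  nth 0%N (betas la) i = (nth 0%N la i + (size la - i.+1))%N.
Proof.
move=> ik; rewrite (nth_map 0%N) ?size_iota // nth_iota // /beta /part add1n /=.
by lia.
Qed.

Lemma betasP la b : reflect (in_beta la b) (b \in betas la).
Proof.
apply: (iffP mapP) => -[i hi ->]; exists i => //.
  by move: hi; rewrite mem_iota; lia.
by rewrite mem_iota; lia.
Qed.

Lemma betas_gt0 la b : b \in betas la -> (0 < b)%N.
Proof.
move=> /betasP[i hi ->]; have := Defs.part_gt0 hi; rewrite /beta; lia.
Qed.

Lemma betas_sorted la : sorted gtn (betas la).
Proof.
apply/(sortedP 0%N) => i; rewrite size_betas => ik.
rewrite /= !nth_betas //; last exact: ltnW.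
by have := @part_mono la i.+1 i.+2 isT (leqnSn _); rewrite /part /=; lia.
Qed.

Lemma gtn_trans : transitive gtn.
Proof. by move=> a b c /= h1 h2; exact: ltn_trans h2 h1. Qed.

Lemma betas_uniq la : uniq (betas la).
Proof.
by apply: (sorted_uniq gtn_trans) (betas_sorted la) => a; rewrite /= ltnn.
Qed.

Lemma betas_inj la la' : betas la =i betas la' -> la = la'.
Proof.
move=> h; have e : betas la = betas la'.
  apply: (irr_sorted_eq gtn_trans) h; rewrite ?betas_sorted // => a.
  by rewrite /= ltnn.
have sz : size la = size la' by rewrite -!size_betas e.
apply: val_inj; apply: (@eq_from_nth _ 0%N) => //= i ik.
by have := nth_betas ik; rewrite e nth_betas -?sz //; lia.
Qed.

Lemma nth_sorted_gtn bs i : sorted gtn bs -> all (leq 1) bs ->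
  (i < size bs)%N -> (size bs - i <= nth 0%N bs i)%N.
Proof.
elim: bs i => // a [|b bs] IH i /=.
  by move=> _ /andP[a0 _]; case: i => //= _; lia.
move=> /andP[ab sb] /andP[a0 ab0]; case: i => [|i] ik /=.
  by have := IH 0%N sb ab0 isT; rewrite /=; lia.
exact: IH.
Qed.

(** Subtracting the staircase [k - 1, ..., 1, 0] leaves the parts, positive by [nth_sorted_gtn]. *)
Lemma betas_surj bs : sorted gtn bs -> all (leq 1) bs ->
  exists la, betas la = bs.
Proof.
move=> sb pb; pose k := size bs.
pose l := mkseq (fun i => nth 0%N bs i - (k - i.+1))%N k.
have lt i : (i < k)%N -> (k - i <= nth 0%N bs i)%N := nth_sorted_gtn sb pb.
have pl : is_partition l.
  apply/andP; split.
    apply/(sortedP 0%N) => i; rewrite size_mkseq => ik.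
    rewrite /= !nth_mkseq //; last exact: ltnW.
    by have /= := sortedP 0%N sb i ik; lia.
  apply/(all_nthP 0%N) => i; rewrite size_mkseq => ik.
  by rewrite nth_mkseq //; have := lt i ik; lia.
exists (IntPart pl); apply: (@eq_from_nth _ 0%N).
  by rewrite size_betas /= size_mkseq.
move=> i; rewrite size_betas /= size_mkseq => ik.
rewrite nth_betas /= size_mkseq // nth_mkseq //.
by have := lt i ik; lia.
Qed.

Lemma sum_betas la :
  (\sum_(b <- betas la) b = psize la + 'C(size la, 2))%N.
Proof.
rewrite (big_nth 0%N) size_betas /psize sumnE [in RHS](big_nth 0%N).
rewrite -bin2_sum [X in (_ + X)%N]big_nat_rev -big_split /=.
rewrite !big_nat; apply: eq_bigr => i /andP[_ ik].
by rewrite nth_betas // add0n.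
Qed.

Definition beta_ideal (la : intpart) (m : Z) : bool :=
  (m <? 0)%BZ || (Z.to_nat m \in betas la).

(** The hook lengths in row [i] are the differences [beta la i - g] over the natural numbers
    [g < beta la i] outside the beta set. *)
Lemma is_coreP u la : is_core u la <->
  (forall b, b \in betas la -> (u <= b)%N -> (b - u)%N \in betas la).
Proof.
split=> [cu b /betasP hb ub|h i j [hi hj] e].
  by apply/betasP; exact: in_betaB.
have exr : exists r, (r <= size la)%N && ((r == 0)%N || (j <= part la r)%N).
  by exists 0%N.
have ubr r : (r <= size la)%N && ((r == 0)%N || (j <= part la r)%N) ->
  (r <= size la)%N by case/andP.
have [r /andP[rk hr] mx] := ex_maxnP exr ubr.
have jr : (part la r.+1 < j)%N.
  rewrite ltnNge; apply/negP => jp; have := mx r.+1; rewrite jp orbT andbT ltnn.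
  have [ek|ek] := ltnP r (size la); first by move=> /(_ isT).
  by move: jp; rewrite /part nth_default //; lia.
have cE : conj_part la j = r by apply: conj_partE => //; lia.
have ir : (i <= r)%N.
  rewrite leqNgt; apply/negP => ri.
  by have := @part_mono la r.+1 i isT ri; lia.
(* A hook of length [u] in row [i] makes [beta la i - u] a gap. *)
have hb : beta la i \in betas la by apply/betasP; exists i.
have eb : (beta la i - u = size la + j - r - 1)%N.
  by rewrite -e /hook_length cE /beta; lia.
have ub : (u <= beta la i)%N by rewrite -e /hook_length cE /beta; lia.
(* This value is below the first-column hook lengths of the rows up to [r] and above those of the
   later rows. *)
have /betasP[i' hi'] := h _ hb ub; rewrite eb /beta => e'.
have [i'r|ri'] := leqP i' r.
  by have := @part_mono la i' r; lia.
by have := @part_mono la r.+1 i' isT ri'; lia.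
Qed.

(** * Cores as ideals *)

Section SizeOfCore.

Variables s t : nat.
Hypotheses (s0 : (0 < s)%N) (t0 : (0 < t)%N) (st : coprime s t).

Let S := Z.of_nat s.
Let T := Z.of_nat t.
Let N := (S + T)%BZ.

Lemma beta_idealP la : cores s t la <-> ideal s t (beta_ideal la).
Proof.
have sub u : (0 < u)%N -> is_core u la <->
    (forall m, beta_ideal la m -> beta_ideal la (m - Z.of_nat u)%BZ).
  move=> u0; rewrite is_coreP; split=> h.
    move=> m; rewrite /beta_ideal => /orP[/Z.ltb_lt m0|mb].
      by apply/orP; left; apply/Z.ltb_lt; lia.
    have [mu|mu] := Z.ltb_spec (m - Z.of_nat u) 0 => //=.
    have -> : Z.to_nat (m - Z.of_nat u) = (Z.to_nat m - u)%N by lia.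
    by apply: h => //; lia.
  move=> b bb ub; have := h (Z.of_nat b); rewrite /beta_ideal Nat2Z.id bb orbT.
  move=> /(_ isT)/orP[/Z.ltb_lt|]; first by lia.
  by have -> : Z.to_nat (Z.of_nat b - Z.of_nat u) = (b - u)%N by lia.
split=> [[/(sub s s0) hs /(sub t t0) ht]|
         [/(sub s s0) hs /(sub t t0) ht _ _] //].
split=> // [m m0|]; first by apply/orP; left; apply/Z.ltb_lt.
by apply/negP => /orP[//|] /betas_gt0.
Qed.

(** The positive elements of a bounded ideal, in decreasing order, form a beta set; 0 is outside the
    ideal, so the enumeration may start at 1. *)
Lemma core_of_ideal M b : ideal s t M -> (forall m, M m -> (m < b)%BZ) ->
  exists2 la, cores s t la & beta_ideal la =1 M.
Proof.
move=> iM Mb; have [_ _ hn h0] := iM.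
pose bs := rev [seq m <- iota 1 (Z.to_nat b) | M (Z.of_nat m)].
have [||la lE] := @betas_surj bs.
- rewrite rev_sorted; apply: sorted_filter (iota_ltn_sorted _ _).
  exact: ltn_trans.
- rewrite all_rev; apply/allP => m; rewrite mem_filter mem_iota.
  by case/and3P.
have e : beta_ideal la =1 M.
  move=> m; rewrite /beta_ideal lE mem_rev mem_filter mem_iota.
  have [/hn -> //|m0] := Z.ltb_spec m 0.
  rewrite Z2Nat.id //; case: (boolP (M m)) => //= Mm.
  have := Mb _ Mm; case: (Z.eq_dec m 0) => [m0'|]; last by lia.
  by rewrite m0' (negbTE h0) in Mm.
exists la => //; apply/beta_idealP; case: iM => h1 h2 _ _.
by split=> [m|m|m|]; rewrite ?e //; [exact: h1 | exact: h2 | exact: hn].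
Qed.

Section OneCore.

Variables (la : intpart) (p : Z).
Hypotheses (hla : cores s t la) (cp : corner s t (beta_ideal la) p).

Let w := trace s t (beta_ideal la) p (s + t).
Let B := [seq Z.of_nat b | b <- betas la].
Let P := [seq (p + x)%BZ | x <- points s t w].

Lemma mem_zbetas x : (x \in B) = (0 <=? x)%BZ && beta_ideal la x.
Proof.
have [x0|x0] := Z.leb_spec 0 x; last first.
  by apply/mapP => -[b _]; lia.
rewrite /beta_ideal; have -> /= : (x <? 0)%BZ = false by lia.
rewrite -{1}(Z2Nat.id x x0) mem_map // => a b; lia.
Qed.

Lemma mem_corners x : (x \in P) = corner s t (beta_ideal la) x.
Proof.
have iM := (beta_idealP la).1 hla.
have -> : x = (p + (x - p))%BZ by lia.
rewrite mem_map => [|a b]; last by lia.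
by rewrite mem_points.
Qed.

(** In a class modulo [N] with least natural number [r] and corner [p], the part of [B] is
    [r, r + N, ..., p - N]. Adding [p] to it gives the same set as translating it by [N] and adding
    [r]. *)
Lemma perm_beta_corners :
  perm_eq (B ++ P)
    ([seq Z.of_nat r | r <- iota 0 (s + t)] ++ [seq (b + N)%BZ | b <- B]).
Proof.
have iM := (beta_idealP la).1 hla; have [_ _ hn _] := iM.
have zinj : injective Z.of_nat by move=> a b; lia.
have N0 : (0 < N)%BZ by rewrite /N /S /T; lia.
have uB : uniq B by rewrite map_inj_uniq ?betas_uniq.
have uP : uniq P.
  by rewrite map_inj_uniq; [exact: points_uniq | move=> a b /=; lia].
have uBN : uniq [seq (b + N)%BZ | b <- B].
  by rewrite map_inj_uniq // => a b /=; lia.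
apply: uniq_perm.
- rewrite cat_uniq uB uP andbT; apply/hasPn => x.
  rewrite /= mem_corners mem_zbetas.
  by case/andP => /negbTE ->; rewrite andbF.
- rewrite cat_uniq (map_inj_uniq zinj) iota_uniq.
  rewrite uBN andbT; apply/hasPn => x /mapP[y yB ->]; apply/mapP => -[r].
  move: yB; rewrite mem_zbetas mem_iota /N /S /T => /andP[/Z.leb_le y0 _]; lia.
move=> x; rewrite !mem_cat mem_corners mem_zbetas /corner -/S -/T -/N.
have -> : (x \in [seq (b + N)%BZ | b <- B]) =
          (N <=? x)%BZ && beta_ideal la (x - N)%BZ.
  apply/mapP/andP => [[y]|[/Z.leb_le xN xM]].
    rewrite mem_zbetas => /andP[/Z.leb_le y0 yM] ->; rewrite Z.add_simpl_r.
    by split=> //; apply/Z.leb_le; lia.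
  exists (x - N)%BZ; last by lia.
  by rewrite mem_zbetas xM andbT; apply/Z.leb_le; lia.
have -> : (x \in [seq Z.of_nat r | r <- iota 0 (s + t)]) =
          (0 <=? x)%BZ && (x <? N)%BZ.
  apply/mapP/idP => [[r]|/andP[/Z.leb_le x0 /Z.ltb_lt xN]].
    by rewrite mem_iota /N /S /T => hr ->; lia.
  exists (Z.to_nat x); rewrite ?mem_iota ?Z2Nat.id //.
  by move: xN; rewrite /N /S /T; lia.
have Mx := idealB s0 t0 st iM 1.
have {}Mx : beta_ideal la x -> beta_ideal la (x - N)%BZ.
  move=> /Mx.
  by have -> : (x - Z.of_nat 1 * (S + T) = x - N)%BZ by rewrite /N; lia.
have [x0|x0] := Z.leb_spec 0 x; last first.
  by rewrite hn //=; have -> : (N <=? x)%BZ = false by lia.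
have [xN|xN] := Z.ltb_spec x N => /=.
  have -> : beta_ideal la (x - N)%BZ by apply: hn; lia.
  by rewrite andbT orbN.
have -> /= : (N <=? x)%BZ = true by lia.
by case: (beta_ideal la x) Mx => //= ->.
Qed.

End OneCore.

End SizeOfCore.

(** * The size of a core *)

Lemma sum_add_const (l : seq Z) (a : Z) :
  \sum_(x <- l) (a + x)%BZ =
  (Z.of_nat (size l) * a + (\sum_(x <- l) x)%R)%BZ :> Z.
Proof.
elim: l => [|y l IH]; first by rewrite !big_nil.
rewrite !big_cons IH -![(_ + _)%R]/(Z.add _ _) -[size (y :: l)]/(size l).+1.
rewrite Nat2Z.inj_succ.
by move: (\sum_(i <- _) _) => z; ring.
Qed.

Lemma sum_sqr_add_const (l : seq Z) (a : Z) :
  \sum_(x <- l) ((a + x) * (a + x))%BZ =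
  (Z.of_nat (size l) * (a * a) + 2 * a * (\sum_(x <- l) x)%R
   + (\sum_(x <- l) (x * x)%BZ)%R)%BZ :> Z.
Proof.
elim: l => [|y l IH]; first by rewrite !big_nil /= Z.mul_0_r.
rewrite !big_cons IH -![(_ + _)%R]/(Z.add _ _) -[size (y :: l)]/(size l).+1.
rewrite Nat2Z.inj_succ.
by move: (\sum_(i <- _) _) => z; move: (\sum_(i <- _) _) => z'; ring.
Qed.

Lemma sum_iotaS (F : nat -> Z) n :
  \sum_(r <- iota 0 n.+1) F r = ((\sum_(r <- iota 0 n) F r)%R + F n)%BZ :> Z.
Proof. by rewrite -addn1 iotaD big_cat /= big_seq1. Qed.

Lemma sum_iota n :
  (2 * (\sum_(r <- iota 0 n) Z.of_nat r)%R = Z.of_nat n * (Z.of_nat n - 1))%BZ.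
Proof.
elim: n => [|n IH]; first by rewrite big_nil.
by rewrite sum_iotaS Nat2Z.inj_succ Z.mul_add_distr_l IH; ring.
Qed.

Lemma sum_sqr_iota n :
  (6 * (\sum_(r <- iota 0 n) (Z.of_nat r * Z.of_nat r)%BZ)%R =
   Z.of_nat n * (Z.of_nat n - 1) * (2 * Z.of_nat n - 1))%BZ.
Proof.
elim: n => [|n IH]; first by rewrite big_nil.
by rewrite sum_iotaS Nat2Z.inj_succ Z.mul_add_distr_l IH; ring.
Qed.

Lemma size_words n j : size (words n j) = 'C(n, j).
Proof.
elim: n j => [|n IH] [|j] //=; rewrite ?size_cat ?size_map ?IH //.
by rewrite addn0 !bin0.
Qed.

(** Elimination of [k], the number of parts. [X] is the size, [X + C] and [B2] are the sums of the
    beta set and of its squares, [R1] and [R2] those of [0, ..., N - 1], and [D1] and [D2] those of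
    the corners relative to [p]. *)
Lemma size_from_moments (N p k X C B2 R1 R2 D1 D2 E : Z) : (0 < N ->
  6 * R2 = N * (N - 1) * (2 * N - 1) -> 2 * R1 = N * (N - 1) ->
  (X + C) + (N * p + D1) = R1 + (k * N + (X + C)) ->
  B2 + (N * (p * p) + 2 * p * D1 + D2) =
    R2 + (k * (N * N) + 2 * N * (X + C) + B2) ->
  2 * C = k * (k - 1) ->
  12 * (N * D2 - D1 * D1) = N * N * (E + N * N - 1) ->
  24 * X = E)%BZ.
Proof.
move=> N0 h2 h1 e1 e2 hC hD; apply: (@Z.mul_reg_l _ _ (N * N)%BZ); first by nia.
have d1 : (2 * D1 = N * (N - 1) + 2 * k * N - 2 * N * p)%BZ by lia.
have d2 : (6 * D2 = N * (N - 1) * (2 * N - 1) + 6 * k * N * N + 12 * N * X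
    + 6 * N * (k * (k - 1)) - 6 * N * p * p - 6 * p * (2 * D1))%BZ.
  by rewrite -h2 -hC; lia.
transitivity (12 * (N * D2 - D1 * D1) - N * N * (N * N - 1))%BZ; last first.
  by rewrite hD; ring.
transitivity (2 * N * (6 * D2) - 3 * (2 * D1) * (2 * D1)
  - N * N * (N * N - 1))%BZ; last by ring.
by rewrite d2 d1; ring.
Qed.

Section PointSums.

Variables s t : nat.
Let S := Z.of_nat s.
Let T := Z.of_nat t.

(* Summation by parts expresses the sums over the [false] steps through the
   sums over the [true] steps. *)
Lemma sum_points w (I := trues w) (J := falses w) :
  (2 * (\sum_(x <- points s t w) x)%R =
   S * (I * (I - 1) + 2 * (I * J - statC w))
   - T * (2 * statC w + J * (J - 1)))%BZ.
Proof.
rewrite /I /J {I J}; elim: w => [|b w IH].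
  by rewrite big_nil /trues /falses /statC /=; lia.
rewrite big_cons -[(_ + _)%R]/(Z.add _ _) -/(points s t w) Z.mul_add_distr_l IH.
rewrite /disp -/S -/T.
have -> : statC (b :: w) = (statC w + if b then falses w else 0)%BZ by [].
have -> : trues (b :: w) = (trues w + if b then 1 else 0)%BZ.
  by rewrite /trues; case: b => /=; lia.
have -> : falses (b :: w) = (falses w + if b then 0 else 1)%BZ.
  by rewrite /falses; case: b => /=; lia.
by case: b; ring.
Qed.

(** The sums of [i ^ 2] and [i j] over the [false] steps come from telescoping [i ^ 2 j] and
    [i j (j - 1)]. *)
Lemma sum_sqr_points w (I := trues w) (J := falses w) :
  (6 * (\sum_(x <- points s t w) (x * x)%BZ)%R =
   S * S * (I * (I - 1) * (2 * I - 1)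
     + 6 * (I * I * J - 2 * statA w - statC w))
   - 2 * S * T * (6 * statA w + 3 * I * J * (J - 1)
     - 3 * statB w + 3 * statC w)
   + T * T * (6 * statB w + J * (J - 1) * (2 * J - 1)))%BZ.
Proof.
rewrite /I /J {I J}; elim: w => [|b w IH].
  by rewrite big_nil /trues /falses /statA /statB /statC /=; lia.
rewrite big_cons -[(_ + _)%R]/(Z.add _ _) -/(points s t w) Z.mul_add_distr_l IH.
rewrite /disp -/S -/T.
have -> : statA (b :: w) =
  (statA w + if b then trues w * falses w else 0)%BZ by [].
have -> : statB (b :: w) =
  (statB w + if b then falses w * falses w else 0)%BZ by [].
have -> : statC (b :: w) = (statC w + if b then falses w else 0)%BZ by [].
have -> : trues (b :: w) = (trues w + if b then 1 else 0)%BZ.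
  by rewrite /trues; case: b => /=; lia.
have -> : falses (b :: w) = (falses w + if b then 0 else 1)%BZ.
  by rewrite /falses; case: b => /=; lia.
by case: b; ring.
Qed.

(** With the letter counts fixed to [t] and [s], the factor [N ^ 2] splits off, and [dev] collects
    what depends on the order of the letters. *)
Lemma dev_points w (N := (S + T)%BZ)
    (D1 := (\sum_(x <- points s t w) x)%R : Z)
    (D2 := (\sum_(x <- points s t w) (x * x)%BZ)%R : Z) :
  trues w = T -> falses w = S ->
  (12 * (N * D2 - D1 * D1) =
   N * N * (dev T S w + (T - 1) * (S - 1) * (N + 1) + N * N - 1))%BZ.
Proof.
move=> wT wS; have e1 := sum_points w; have e2 := sum_sqr_points w.
rewrite wT wS -/D1 -/D2 in e1 e2; move: D1 D2 e1 e2 => D1 D2 e1 e2.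
transitivity (2 * (S + T) * (6 * D2) - 3 * (2 * D1) * (2 * D1))%BZ.
  by rewrite /N; ring.
by rewrite e1 e2 /dev /N; ring.
Qed.

End PointSums.

(** * Counting cores by words *)

Section Counting.

Variables s t : nat.
Hypotheses (s0 : (0 < s)%N) (t0 : (0 < t)%N) (st : coprime s t).

Let S := Z.of_nat s.
Let T := Z.of_nat t.
Let N := (S + T)%BZ.

(** Equating the sums of first and second powers across [perm_beta_corners] cancels the squares of
    the beta set and leaves its sum, hence the size. *)
Lemma size_dev la p : cores s t la -> corner s t (beta_ideal la) p ->
  (24 * Z.of_nat (psize la) =
   dev T S (trace s t (beta_ideal la) p (s + t))
   + (T - 1) * (S - 1) * (N + 1))%BZ.
Proof.
move=> hla cp; set w := trace _ _ _ _ _.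
have iM := (beta_idealP s0 t0 st la).1 hla.
have ww : w \in words (s + t) s := trace_words s0 t0 st iM cp.
have D := dev_points (trues_word s0 t0 st ww) (falses_word ww).
have pm := perm_beta_corners s0 t0 st hla cp.
set L1 := _ ++ _ in pm; set L2 := _ ++ _ in pm.
have e1 : \sum_(x <- L1) x = \sum_(x <- L2) x :> Z by apply: perm_big.
have e2 : \sum_(x <- L1) (x * x)%BZ = \sum_(x <- L2) (x * x)%BZ :> Z.
  by apply: perm_big.
have kN : Z.of_nat (s + t) = N by rewrite /N /S /T; lia.
have k2 : (2 * Z.of_nat 'C(size la, 2) =
           Z.of_nat (size la) * (Z.of_nat (size la) - 1))%BZ.
  by rewrite -sum_iota -bin2_sum /index_iota subn0; elim/big_ind2: _ => //; lia.
have sB : \sum_(x <- [seq Z.of_nat b | b <- betas la]) x =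
          Z.of_nat (psize la + 'C(size la, 2)).
  by rewrite big_map -sum_betas; elim/big_ind2: _ => // *; lia.
have bN : [seq (b + N)%BZ | b <- [seq Z.of_nat b | b <- betas la]] =
          [seq (N + b)%BZ | b <- [seq Z.of_nat b | b <- betas la]].
  by apply: eq_map => b; lia.
rewrite /L1 /L2 -/S -/T -/N bN !big_cat /= in e1 e2.
rewrite ![\sum_(i <- map (Z.add _) _) _]big_map in e1 e2.
rewrite !sum_add_const !size_map size_iota size_points size_trace sB kN in e1.
rewrite !sum_sqr_add_const !size_map size_iota size_points size_trace in e2.
rewrite sB kN in e2.
rewrite ![\sum_(i <- map _ (iota _ _)) _]big_map Nat2Z.inj_add in e1 e2.
have h1 := sum_iota (s + t); have h2 := sum_sqr_iota (s + t).
rewrite kN in h1 h2.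
by apply: size_from_moments h2 h1 e1 e2 k2 D; rewrite /N /S /T; lia.
Qed.

(** A corner is named by its index on the walk from the corner 0, so that all cores share one index
    set. *)
Definition core_word (la : intpart) (k : nat) : seq bool :=
  trace s t (beta_ideal la) (iter k (next s t (beta_ideal la)) 0%BZ) (s + t).

Lemma mem_cores la : (la \in fset_set (cores s t)) -> cores s t la.
Proof. by rewrite in_fset_set ?inE //; exact: finite_cores. Qed.

(** Every word arises by [word_idealP] and [core_of_ideal], and only once by [trace_inj], as the
    ideal determines the core and the corner its index. *)
Lemma perm_core_words :
  perm_eq [seq core_word la k | la <- fset_set (cores s t), k <- iota 0 (s + t)]
          (words (s + t) s).
Proof.
have iM la : la \in fset_set (cores s t) -> ideal s t (beta_ideal la).
  by move=> /mem_cores hla; exact/beta_idealP.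
have co la k : la \in fset_set (cores s t) ->
    corner s t (beta_ideal la) (iter k (next s t (beta_ideal la)) 0%BZ).
  by move=> /iM h; apply: corner_iter => //; exact: corner0.
apply: uniq_perm; last 1 first.
- move=> w; apply/allpairsP/idP => [[[la k] [/= hla _ ->]]|ww].
    by apply: trace_words => //; [exact: iM | exact: co].
  have [M [p [idM cp tw [b Mb]]]] := word_idealP s0 t0 st ww.
  have [la hla e] := core_of_ideal s0 t0 st idM Mb.
  have eM : beta_ideal la = M by apply: funext.
  have [k kN kE] := corner_iterP s0 t0 st idM (corner0 s0 t0 st idM) cp.
  exists (la, k); split=> /=.
  + by rewrite in_fset_set ?inE //; exact: finite_cores.
  + by rewrite mem_iota.
  + by rewrite /core_word eM kE tw.
- apply: allpairs_uniq; rewrite ?fset_uniq ?iota_uniq //.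
  move=> _ _ /allpairsP[[la k] [/= hla kN ->]]
    /allpairsP[[la' k'] [/= hla' kN' ->]].
  move=> /= /(trace_inj s0 t0 st (iM _ hla) (iM _ hla')
    (co _ _ hla) (co _ _ hla'))[ep eM].
  have el : la = la'.
    apply: betas_inj => b; have := eM (Z.of_nat b).
    rewrite /beta_ideal Nat2Z.id.
    by have -> : (Z.of_nat b <? 0)%BZ = false by lia.
  rewrite -el in ep *; congr pair.
  move: kN kN'; rewrite !mem_iota => kN kN'.
  by apply: (iter_next_inj s0 t0 st _ _ ep); lia.
- exact: words_uniq.
Qed.

(** By [size_dev] the [s + t] words of a core have the same deviation. [F] is arbitrary to cover the
    count, the mean and the cube. *)
Lemma sum_words_dev (F : Z -> rat) :
  \sum_(w <- words (s + t) s) F (dev T S w) =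
  (s + t)%:R * \sum_(la <- fset_set (cores s t))
    F (24 * Z.of_nat (psize la) - (T - 1) * (S - 1) * (N + 1))%BZ.
Proof.
rewrite -(perm_big _ perm_core_words) big_allpairs_dep big_distrr /=.
rewrite [in LHS]big_seq [in RHS]big_seq; apply: eq_bigr => la hla.
have hc := mem_cores hla; have iM := (beta_idealP s0 t0 st la).1 hc.
rewrite (eq_bigr (fun _ => F (24 * Z.of_nat (psize la)
                              - (T - 1) * (S - 1) * (N + 1))%BZ)).
  by rewrite big_const_seq count_predT size_iota iter_addr_0 mulr_natl.
move=> k _; congr F.
have c : corner s t (beta_ideal la) (iter k (next s t (beta_ideal la)) 0%BZ).
  by apply: corner_iter => //; exact: corner0.
by rewrite (size_dev hc c) /core_word; lia.
Qed.

End Counting.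

(* The third moment of the size *)
From mathcomp Require Import ring lra.

Theorem theorem3 (s t : nat) (hs : (0 < s)%N) (ht : (0 < t)%N)
    (hst : coprime s t) :
  let X := fun la : intpart => (psize la)%:R : rat in
  let S : rat := s%:R in
  let T : rat := t%:R in
  expect (cores s t) (fun la => (X la - expect (cores s t) X) ^+ 3) =
    1 / (60 * 1000 + 480) * S * T * (T - 1) * (S - 1) * (S + T + 1) * (S + T) *
      (2 * S ^+ 2 * T + 2 * S * T ^+ 2
        - 3 * S ^+ 2 - 3 * S * T - 3 * T ^+ 2 - 3).
Proof.
move=> X S T.
(* This ring morphism carries the integer identities over to the rationals. *)
pose q (z : Z) : rat := (int_of_Z z)%:~R.
have qD x y : q (x + y)%BZ = q x + q y by rewrite /q -rmorphD -rmorphD.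
have qM x y : q (x * y)%BZ = q x * q y by rewrite /q -rmorphM -rmorphM.
have qN x : q (- x)%BZ = - q x by rewrite /q -rmorphN -rmorphN.
have qB x y : q (x - y)%BZ = q x - q y by rewrite -qN -qD.
have q1 : q 1%BZ = 1 by [].
have qnat n : q (Z.of_nat n) = n%:R.
  by rewrite /q; have -> : int_of_Z (Z.of_nat n) = n%:Z by lia.
set A := fset_set (cores s t); pose c : rat := (T - 1) * (S - 1) * (S + T + 1).
pose Y la : rat := 24 * X la - c.
have qY la : q (24 * Z.of_nat (psize la) - (Z.of_nat t - 1) * (Z.of_nat s - 1) *
    (Z.of_nat s + Z.of_nat t + 1))%BZ = Y la.
  by rewrite qB !qM !qB !qD !qnat q1.
have ST0 : (s + t)%:R != 0 :> rat by rewrite pnatr_eq0; lia.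
have sumE (F : rat -> rat) :
    \sum_(w <- words (s + t) s) F (q (dev (Z.of_nat t) (Z.of_nat s) w)) =
    (s + t)%:R * \sum_(la <- A) F (Y la).
  rewrite (@sum_words_dev s t hs ht hst (fun z => F (q z))); congr (_ * _).
  by apply: eq_bigr => la _; rewrite qY.
have st : (Z.of_nat (s + t) - Z.of_nat s = Z.of_nat t)%BZ by lia.
(* A constant function counts the cores: there are [C(s + t, s) / (s + t)] of them. *)
have card : 'C(s + t, s)%:R = (s + t)%:R * (#|` A|)%:R :> rat.
  have := sumE (fun=> 1); rewrite -size_words.
  by rewrite !big_const_seq !count_predT !iter_addr_0.
have A0 : (#|` A|)%:R != 0 :> rat.
  apply/eqP => A0; move/eqP: card; rewrite A0 mulr0 pnatr_eq0.
  by rewrite -leqn0 leqNgt bin_gt0 leq_addr.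
have Y1 : \sum_(la <- A) Y la = 0.
  apply: (mulfI ST0); rewrite -(sumE id) mulr0.
  have := sum_dev (s + t) s; rewrite st => /(congr1 q).
  by rewrite /q !rmorph_sum.
pose P := S * T * (T - 1) * (S - 1) * (S + T + 1) * (S + T) *
  (2 * S ^+ 2 * T + 2 * S * T ^+ 2 - 3 * S ^+ 2 - 3 * S * T - 3 * T ^+ 2 - 3).
have Y3 : 35 * \sum_(la <- A) Y la ^+ 3 = 8 * (#|` A|)%:R * P.
  apply: (mulfI ST0); rewrite mulrCA -(sumE (fun x => x ^+ 3)).
  have := sum_dev3 (s + t) s; rewrite st !Z.pow_2_r => /(congr1 q).
  rewrite !(qM, qB, qD) !qnat card q1 -/S -/T.
  have -> : q 35%BZ = 35 by []; have -> : q 8%BZ = 8 by [].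
  have -> : q 2%BZ = 2 by []; have -> : q 3%BZ = 3 by [].
  have -> : q (\sum_(w <- words (s + t) s)
                 dev (Z.of_nat t) (Z.of_nat s) w ^+ 3) =
      \sum_(w <- words (s + t) s) q (dev (Z.of_nat t) (Z.of_nat s) w) ^+ 3.
    by rewrite /q !rmorph_sum; apply: eq_bigr => w _; rewrite /= !rmorphXn.
  by move=> ->; rewrite /P; ring.
have mean : expect (cores s t) X = c / 24.
  rewrite /expect -/A; apply: (mulIf A0); rewrite divfK //.
  have := Y1; rewrite /Y sumrB -big_distrr /= big_const_seq count_predT.
  by rewrite iter_addr_0 -mulr_natr => h; lra.
rewrite mean /expect -/A.
have -> : \sum_(la <- A) (X la - c / 24) ^+ 3 =
          (\sum_(la <- A) Y la ^+ 3) / 24 ^+ 3.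
  by rewrite big_distrl; apply: eq_bigr => la _; rewrite /Y /=; field.
move: (\sum_(la <- A) _) Y3 => V Y3.
have -> : V = 8 * (#|` A|)%:R * P / 35 by rewrite -Y3; field.
(* The constants combine as [8 / (35 * 24 ^ 3) = 1 / 60480]. *)
by rewrite /P; field.
Qed.
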